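(* Let $\lambda\neq 0$, let $\Theta\subset\mathbb{R}^d$ be an open convex set, let $\varphi:\Theta\to\mathbb{R}$ be a regular $c_\lambda$-convex function, and let $f:\Theta\to\mathbb{R}$ be differentiable. Let $\theta_t\in\Theta$ be a solution of the conformal mirror descent flow $$\frac{d}{dt}\theta_t=-G_\lambda(\theta_t)^{-1}\nabla_\theta f(\theta_t),$$ with initial value $\theta_0\in\Theta$, and let $\eta_t=\nabla^{(\lambda)}_\theta\varphi(\theta_t)$ be the dual variable under the $\lambda$-mirror map. Then $$\frac{d}{dt}\eta_t=-\Pi_\lambda(\theta_t)\,\bigl(I_d+\lambda\,\eta_t\theta_t^{\top}\bigr)\,\nabla_\theta f(\theta_t),$$ where $\Pi_\lambda(\theta):=1+\lambda\langle\theta,\nabla^{(\lambda)}_\theta\varphi(\theta)\rangle=1+\lambda\langle\theta,\eta\rangle$ with $\eta=\nabla^{(\lambda)}_\theta\varphi(\theta)$.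
   Context: Vectors are column vectors, $\langle\cdot,\cdot\rangle$ is the Euclidean inner product, $I_d$ is the $d\times d$ identity matrix, and $\nabla_\theta$ is the Euclidean gradient. Fix $\lambda\neq0$. Regular $c_\lambda$-convex function: a smooth function $\varphi:\Theta\to\mathbb{R}$ on an open convex set $\Theta\subset\mathbb{R}^d$ such that $\Phi_\lambda=\frac1\lambda(e^{\lambda\varphi}-1)$ is convex with $\nabla^2_\theta\Phi_\lambda$ positive definite everywhere, and $1-\lambda\langle\nabla_\theta\varphi(\theta),\theta\rangle>0$ for all $\theta\in\Theta$. The $\lambda$-mirror map ($c_\lambda$-gradient) of $\varphi$ is $$\nabla^{(\lambda)}_\theta\varphi(\theta)=\frac{1}{1-\lambda\langle\nabla_\theta\varphi(\theta),\theta\rangle}\nabla_\theta\varphi(\theta).$$ It is a diffeomorphism from $\Theta$ onto its range $H$; $\eta=\nabla^{(\lambda)}_\theta\varphi(\theta)$ is called the dual variable. The Riemannian metric induced by the $\lambda$-logarithmic divergence of $\varphi$ has, in the primal coordinates $\theta$, the matrix $$G_\lambda(\theta)=\nabla^2_\theta\varphi(\theta)+\lambda(\nabla_\theta\varphi(\theta))(\nabla_\theta\varphi(\theta))^\top=e^{-\lambda\varphi(\theta)}\nabla^2_\theta\Phi_\lambda(\theta).$$ *)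

(* Defs.v *)
From HB Require Import structures.
From mathcomp Require Import all_boot all_order all_algebra.
From mathcomp Require Import all_classical all_reals all_analysis.

Set Implicit Arguments.
Unset Strict Implicit.
Unset Printing Implicit Defensive.

Import Order.TTheory GRing.Theory Num.Theory.
Import numFieldNormedType.Exports.

Local Open Scope classical_set_scope.
Local Open Scope ring_scope.

(* Functions on Theta are total functions on 'cV[R]_d; since Theta is open,
   their derivatives at points of Theta only see their values on Theta. *)

Definition inner (R : realType) (d : nat) (u v : 'cV[R]_d) : R :=
  (u^T *m v) 0 0.

Definition partial (R : realType) (d : nat) (i : 'I_d) (g : 'cV[R]_d -> R)
    (x : 'cV[R]_d) : R :=
  'D_(delta_mx i 0) g x.

Definition grad (R : realType) (d : nat) (g : 'cV[R]_d -> R)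
    (x : 'cV[R]_d) : 'cV[R]_d :=
  \col_i partial i g x.

(* The Jacobian matrix of the gradient: entry (i, j) is d_j (d_i g). *)
Definition hessian (R : realType) (d : nat) (g : 'cV[R]_d -> R)
    (x : 'cV[R]_d) : 'M[R]_d :=
  \matrix_(i, j) partial j (partial i g) x.

(* C^k on an open set: C^0 is continuity, and C^(k+1) means (Frechet)
   differentiable with a derivative whose components are C^k. *)
Fixpoint Ck (R : realType) (d k : nat) (Theta : set 'cV[R]_d)
    (g : 'cV[R]_d -> R) : Prop :=
  if k is k'.+1 then
    (forall x, Theta x -> differentiable g x) /\
    (forall i, Ck k' Theta (partial i g))
  else forall x, Theta x -> {for x, continuous g}.

Definition smooth_on (R : realType) (d : nat) (Theta : set 'cV[R]_d)
    (g : 'cV[R]_d -> R) : Prop :=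
  forall k, Ck k Theta g.

(* Only applied to Hessians of smooth functions, which are symmetric. *)
Definition posdef (R : realType) (d : nat) (A : 'M[R]_d) : Prop :=
  forall v : 'cV[R]_d, v != 0 -> 0 < inner v (A *m v).

Definition Phi_lam (R : realType) (d : nat) (lam : R) (phi : 'cV[R]_d -> R)
    (x : 'cV[R]_d) : R :=
  lam^-1 * (expR (lam * phi x) - 1).

Record regular_c_convex (R : realType) (d : nat) (lam : R)
    (Theta : set 'cV[R]_d) (phi : 'cV[R]_d -> R) : Prop := {
  rcc_smooth : smooth_on Theta phi ;
  rcc_convex : convex_function Theta (Phi_lam lam phi) ;
  rcc_posdef : forall x, Theta x -> posdef (hessian (Phi_lam lam phi) x) ;
  rcc_pos : forall x, Theta x -> 0 < 1 - lam * inner (grad phi x) x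
}.

Definition mirror_map (R : realType) (d : nat) (lam : R)
    (phi : 'cV[R]_d -> R) (x : 'cV[R]_d) : 'cV[R]_d :=
  (1 - lam * inner (grad phi x) x)^-1 *: grad phi x.

Definition metric (R : realType) (d : nat) (lam : R)
    (phi : 'cV[R]_d -> R) (x : 'cV[R]_d) : 'M[R]_d :=
  hessian phi x + lam *: (grad phi x *m (grad phi x)^T).

Definition Pi_lam (R : realType) (d : nat) (lam : R)
    (phi : 'cV[R]_d -> R) (x : 'cV[R]_d) : R :=
  1 + lam * inner x (mirror_map lam phi x).

(* u has derivative v at t relative to J: the two-sided derivative if t is
   interior to J, the one-sided one if t is an endpoint of the interval J. *)
Definition is_derive_within (R : realType) (d : nat) (J : set R) (t : R)
    (u : R -> 'cV[R]_d) (v : 'cV[R]_d) : Prop :=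
  (s - t)^-1 *: (u s - u t) @[s --> within (J `\ t) (nbhs t)] --> v.

(* theta is a solution on the time interval J, for instance [0, T[,
   [0, +oo[ or an open interval around 0. *)
Record conformal_mirror_flow (R : realType) (d : nat) (lam : R)
    (Theta : set 'cV[R]_d) (phi f : 'cV[R]_d -> R) (J : set R)
    (theta0 : 'cV[R]_d) (theta : R -> 'cV[R]_d) : Prop := {
  cmf_itv : is_interval J ;
  cmf_nondegenerate : J `\ 0 !=set0 ;
  cmf_J0 : J 0 ;
  cmf_in : forall t, J t -> Theta (theta t) ;
  cmf_init : theta 0 = theta0 ;
  cmf_ode : forall t, J t ->
    is_derive_within J t theta
      (- (invmx (metric lam phi (theta t)) *m grad f (theta t)))
}.

(* Main.v *)
Require Import Defs.
From HB Require Import structures.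
From mathcomp Require Import all_boot all_order all_algebra.
From mathcomp Require Import all_classical all_reals all_analysis.
From mathcomp Require Import ring.

Import Order.TTheory GRing.Theory Num.Theory.
Import numFieldNormedType.Exports.

Local Open Scope classical_set_scope.
Local Open Scope ring_scope.

Set Implicit Arguments.
Unset Strict Implicit.

(** Write [g] for the gradient of [phi] at the point [x] of the curve, [H] for
    its Hessian, [D = 1 - lam <g, x>] and [v] for the velocity, so that
    [eta = g / D].  The chain rule along the curve reduces the claim to the
    directional derivative of the mirror map, and the quotient rule gives

      eta' = H v / D + lam (<g, v> + <x, H v>) g / D^2.

    Put [w = G v] with [G = H + lam g g^T]; then [H v = w - lam <g, v> g], hence
    [<g, v> + <x, H v> = D <g, v> + <x, w>].  The two terms in [<g, v>] cancel
    and there remains [w / D + lam <x, w> g / D^2], which is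
    [(1 / D) (I + lam eta x^T) w].  Finally [Pi_lam = 1 + lam <x, g> / D = 1 / D].
    This identity ([derive_mirror_map_coord]) holds for every direction [v].

    The flow enters only through [w]: its equation is [v = - G^-1 grad f], and
    this gives [w = - grad f] once [G] is known to be invertible
    ([metric_unitmx]).  Invertibility comes from convexity: the Hessian of
    [Phi_lam] is [e^(lam phi) G] ([hessian_Phi_lam]) and is positive definite.

    Since the flow may live on an interval with endpoints, the curve only has a
    derivative relative to that interval; the chain rule is therefore proved for
    difference quotients along an arbitrary filter ([cvg_quotient_diff]). *)

(** * Difference quotients along a filter *)

(** The first-order expansion of [g] at [x], divided by [h s]: the remainder is
    [o(u s - x)], and [`|u s - x| / `|h s|] stays bounded because it is the norm
    of a convergent quotient. *)
Lemma cvg_quotient_diff (R : realType) (V W : normedModType R) (T : Type)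
    (F : set_system T) (FF : Filter F) (h : T -> R) (u : T -> V) (x v : V)
    (g : V -> W) :
  (\forall s \near F, h s != 0) -> h s @[s --> F] --> 0 ->
  (h s)^-1 *: (u s - x) @[s --> F] --> v ->
  differentiable g x ->
  (h s)^-1 *: (g (u s) - g x) @[s --> F] --> 'd g x v.
Proof.
move=> hne h0; set q := (fun s => _) => qv dg.
have hq : \forall s \near F, h s *: q s = u s - x.
  by near=> s; rewrite /q scalerA divff ?scale1r //; near: s.
have Fu : u s - x @[s --> F] --> (0 : V).
  apply: cvg_trans (near_eq_cvg hq) _.
  by rewrite -(scale0r v); exact: cvgZ.
have [dgc /eqaddoP dge] := (diff_locallyP x g).1 dg.
apply: (@cvg_sub0 _ _ _ _ _ _ ('d g x \o q)); last first.
  by apply: cvg_comp qv _; exact: dgc.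
apply/cvgr0Pnorm_le => e e0.
(* Eventually `|q s| < `|v| + 1, so this slope bounds the error by e. *)
have e'0 : 0 < e / (`|v| + 1) by rewrite divr_gt0 // ltr_wpDl.
have := Fu _ (dge _ e'0); rewrite /nbhs/= => near_lin.
near=> s.
have -> : ((fun s => (h s)^-1 *: (g (u s) - g x)) - ('d g x \o q)) s
   = (h s)^-1 *: (g (u s) - (g x + 'd g x (u s - x))).
  by rewrite /= !fctE /= /q linearZ -scalerBr opprD addrA.
rewrite normrZ.
have : `|g (u s) - (g x + 'd g x (u s - x))| <= e / (`|v| + 1) * `|u s - x|.
  near: s; apply: filterS near_lin => s /=.
  by rewrite !fctE /= subrK.
move=> /(ler_wpM2l (normr_ge0 (h s)^-1)) /le_trans; apply.
rewrite mulrCA -normrZ -/(q s) mulrAC ler_pdivrMr ?ltr_wpDl //.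
rewrite ler_pM2l // ltW //; near: s.
by apply: (cvgr_norm_lt v qv); rewrite ltrDl.
Unshelve. all: by end_near.
Qed.

Lemma cvg_col (R : realType) (d : nat) (T : Type) (F : set_system T)
    (FF : Filter F) (u : T -> 'cV[R]_d) (v : 'cV[R]_d) :
  (forall i, u s i 0 @[s --> F] --> v i 0) -> u s @[s --> F] --> v.
Proof.
move=> uv; apply/cvg_ballP => e e0.
have /filter_forall : forall i, \forall s \near F, ball (v i 0) e (u s i 0).
  by move=> i; move/cvg_ballP: (uv i); exact.
by apply: filterS => s us; split => // i j; rewrite ord1.
Qed.

(** * The inner product *)

Lemma innerE (R : realType) (d : nat) (u v : 'cV[R]_d) :
  inner u v = \sum_i u i 0 * v i 0.
Proof. by rewrite /inner mxE; apply: eq_bigr => i _; rewrite mxE. Qed.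

Lemma innerC (R : realType) (d : nat) (u v : 'cV[R]_d) : inner u v = inner v u.
Proof. by rewrite !innerE; apply: eq_bigr => i _; rewrite mulrC. Qed.

Lemma innerZr (R : realType) (d : nat) (a : R) (u v : 'cV[R]_d) :
  inner u (a *: v) = a * inner u v.
Proof. by rewrite /inner -scalemxAr mxE. Qed.

Lemma innerBr (R : realType) (d : nat) (u v w : 'cV[R]_d) :
  inner u (v - w) = inner u v - inner u w.
Proof. by rewrite /inner mulmxBr !mxE. Qed.

Lemma posdef_unitmx (R : realType) (d : nat) (A : 'M[R]_d) :
  posdef A -> A \in unitmx.
Proof.
move=> Apos; rewrite -unitmx_tr -row_free_unit; apply: inj_row_free => w wA0.
have [//|w0] := eqVneq w^T 0; first by move=> /(congr1 trmx); rewrite trmxK trmx0.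
have := Apos _ w0; rewrite -[A]trmxK -trmx_mul wA0 trmx0 /inner mulmx0 mxE ltxx.
by [].
Qed.

(** * Directional derivatives *)

Lemma derive_partialE (R : realType) (d : nat) (g : 'cV[R]_d -> R)
    (x v : 'cV[R]_d) :
  differentiable g x -> 'D_v g x = \sum_j v j 0 * partial j g x.
Proof.
move=> dg; rewrite deriveE // {1}(matrix_sum_delta v) linear_sum.
by apply: eq_bigr => j _; rewrite big_ord1 linearZ /partial deriveE.
Qed.

Lemma derive_partial_hessian (R : realType) (d : nat) (g : 'cV[R]_d -> R)
    (x v : 'cV[R]_d) (i : 'I_d) :
  differentiable (partial i g) x ->
  'D_v (partial i g) x = (hessian g x *m v) i 0.
Proof.
move=> dg; rewrite derive_partialE // mxE; apply: eq_bigr => j _.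
by rewrite mxE mulrC.
Qed.

Lemma derive_comp1 (R : realType) (V : normedModType R) (h : R -> R)
    (g : V -> R) (x v : V) (l : R) :
  is_derive (g x) 1 h l -> differentiable g x ->
  'D_v (h \o g) x = l * 'D_v g x.
Proof.
move=> [hd <-] dg.
have dh : differentiable h (g x) by apply/derivable1_diffP.
rewrite deriveE; last exact: differentiable_comp.
by rewrite diff_comp //= diff1E // -derive1E deriveE // mulrC.
Qed.

Lemma is_derive_coord (R : realType) (d : nat) (k : 'I_d) (x v : 'cV[R]_d) :
  is_derive x v (fun y : 'cV[R]_d => y k 0) (v k 0).
Proof.
apply: DeriveDef; first exact/diff_derivable/differentiable_coord.
have := @derive_id _ _ x v; rewrite derive_mx; last exact: derivable_id.
by move=> /matrixP/(_ k 0); rewrite mxE.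
Qed.

(** * Invertibility of the metric *)

Lemma partial_Phi_lam (R : realType) (d : nat) (lam : R) (phi : 'cV[R]_d -> R)
    (i : 'I_d) (x : 'cV[R]_d) :
  lam != 0 -> differentiable phi x ->
  partial i (Phi_lam lam phi) x = expR (lam * phi x) * partial i phi x.
Proof.
move=> lam0 dphi; rewrite /partial.
rewrite -[Phi_lam _ _]/((fun z => lam^-1 * (expR (lam * z) - 1)) \o phi).
apply: derive_comp1 dphi.
have hl : is_derive (phi x) 1 (lam \*: @id R) lam.
  by apply: is_derive_eq; rewrite /GRing.scale/= mulr1.
have he : is_derive (phi x) 1 (lam^-1 \*: ((expR \o (lam \*: @id R)) - cst 1))
    (expR (lam * phi x)).
  by apply: is_derive_eq; rewrite subr0 /GRing.scale/= mulrCA mulVf // mulr1.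
exact: he.
Qed.

(** Differentiating [e^(lam phi) d_i phi] once more: the derivative of the
    exponential factor contributes the rank-one part [lam g g^T] of the metric. *)
Lemma hessian_Phi_lam (R : realType) (d : nat) (lam : R) (phi : 'cV[R]_d -> R)
    (x : 'cV[R]_d) :
  lam != 0 -> {near x, forall y, differentiable phi y} ->
  (forall i, differentiable (partial i phi) x) ->
  hessian (Phi_lam lam phi) x = expR (lam * phi x) *: metric lam phi x.
Proof.
move=> lam0 dphi dpphi; apply/matrixP => i j; rewrite !mxE big_ord1 !mxE.
have dx : differentiable phi x by exact: nbhs_singleton dphi.
rewrite {1}/partial.
(* The formula for the first derivative is known only near x. *)
rewrite (@near_eq_derive _ _ _ _
  ((expR \o (fun y => lam * phi y)) * partial i phi)); last first.
  by near=> y; rewrite partial_Phi_lam //; near: y.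
have dl : differentiable (fun y => lam * phi y) x by exact: differentiableZ.
have de : differentiable (expR \o (fun y => lam * phi y)) x.
  apply: differentiable_comp dl _; apply/derivable1_diffP.
  exact: derivable_expR.
rewrite deriveM; [|exact: diff_derivable..].
rewrite (derive_comp1 _ (is_derive_expR _) dl) deriveZ; last first.
  exact: diff_derivable.
rewrite /= -!/(partial j _ _) /GRing.scale/=.
by ring.
Unshelve. all: by end_near.
Qed.

Lemma metric_unitmx (R : realType) (d : nat) (lam : R) (Theta : set 'cV[R]_d)
    (phi : 'cV[R]_d -> R) (x : 'cV[R]_d) :
  lam != 0 -> open Theta -> regular_c_convex lam Theta phi -> Theta x ->
  metric lam phi x \in unitmx.
Proof.
move=> lam0 oT [smooth _ pos _] Tx.
have [dphi dp] := smooth 2%N.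
have /posdef_unitmx := pos x Tx.
rewrite hessian_Phi_lam //; last 2 first.
- by apply: filterS (open_nbhs_nbhs (conj oT Tx)).
- by move=> i; exact: (dp i).1.
by rewrite unitmxZ // unitfE gt_eqF // expR_gt0.
Qed.

(** * Derivative of the mirror map *)

Lemma inner_grad_sumE (R : realType) (d : nat) (phi : 'cV[R]_d -> R) :
  (fun y => inner (grad phi y) y) =
  \sum_(k < d) (partial k phi * (fun y : 'cV[R]_d => y k 0)).
Proof.
apply/funext => y; rewrite innerE fct_sumE; apply: eq_bigr => k _.
by rewrite mxE.
Qed.

Lemma differentiable_inner_grad (R : realType) (d : nat) (phi : 'cV[R]_d -> R)
    (x : 'cV[R]_d) :
  (forall i, differentiable (partial i phi) x) ->
  differentiable (fun y => inner (grad phi y) y) x.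
Proof.
move=> dp; rewrite inner_grad_sumE.
apply: differentiable_sum => k; apply: differentiableM => //.
exact: differentiable_coord.
Qed.

Lemma derive_inner_grad (R : realType) (d : nat) (phi : 'cV[R]_d -> R)
    (x v : 'cV[R]_d) :
  (forall i, differentiable (partial i phi) x) ->
  'D_v (fun y => inner (grad phi y) y) x =
    inner (grad phi x) v + inner x (hessian phi x *m v).
Proof.
move=> dp; rewrite inner_grad_sumE.
apply: derive_val; apply: is_derive_eq.
  apply: is_derive_sum => k; apply: is_deriveM; last exact: is_derive_coord.
  exact/derivableP/diff_derivable.
rewrite !innerE -big_split; apply: eq_bigr => k _ /=.
by rewrite derive_partial_hessian // [grad _ _ _ _]mxE.
Qed.

Definition mirror_denom (R : realType) (d : nat) (lam : R)
    (phi : 'cV[R]_d -> R) (y : 'cV[R]_d) : R :=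
  1 - lam * inner (grad phi y) y.

Lemma mirror_map_coordE (R : realType) (d : nat) (lam : R)
    (phi : 'cV[R]_d -> R) (i : 'I_d) :
  (fun y => mirror_map lam phi y i 0) =
  (fun y => (mirror_denom lam phi y)^-1) * partial i phi.
Proof. by apply/funext => y; rewrite /mirror_map !mxE. Qed.

Lemma differentiable_mirror_denom (R : realType) (d : nat) (lam : R)
    (phi : 'cV[R]_d -> R) (x : 'cV[R]_d) :
  (forall i, differentiable (partial i phi) x) ->
  differentiable (mirror_denom lam phi) x.
Proof.
move=> dp; apply: differentiableB => //; apply: differentiableZ.
exact: differentiable_inner_grad.
Qed.

Lemma derive_mirror_denom (R : realType) (d : nat) (lam : R)
    (phi : 'cV[R]_d -> R) (x v : 'cV[R]_d) :
  (forall i, differentiable (partial i phi) x) ->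
  'D_v (mirror_denom lam phi) x =
    - (lam * (inner (grad phi x) v + inner x (hessian phi x *m v))).
Proof.
move=> dp.
have di : differentiable (fun y => inner (grad phi y) y) x.
  exact: differentiable_inner_grad.
rewrite [mirror_denom _ _](_ : _ =
  cst 1 - lam \*: (fun y => inner (grad phi y) y)) //.
rewrite deriveB; [|exact: derivable_cst|exact/derivableZ/diff_derivable].
rewrite derive_cst sub0r deriveZ; last exact: diff_derivable.
by rewrite derive_inner_grad.
Qed.

Lemma differentiable_mirror_map_coord (R : realType) (d : nat) (lam : R)
    (phi : 'cV[R]_d -> R) (x : 'cV[R]_d) (i : 'I_d) :
  (forall i, differentiable (partial i phi) x) ->
  mirror_denom lam phi x != 0 ->
  differentiable (fun y => mirror_map lam phi y i 0) x.
Proof.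
move=> dp D0; rewrite mirror_map_coordE; apply: differentiableM => //.
exact: (differentiableV (differentiable_mirror_denom _ dp) D0).
Qed.

(** Row by row, the Jacobian of the mirror map is [Pi_lam (I + lam eta x^T) G].
    Expressing it through [G] instead of the Hessian is what makes the two
    contributions of [<grad phi, v>] in the quotient rule cancel. *)
Lemma derive_mirror_map_coord (R : realType) (d : nat) (lam : R)
    (phi : 'cV[R]_d -> R) (x v : 'cV[R]_d) (i : 'I_d) :
  (forall i, differentiable (partial i phi) x) ->
  mirror_denom lam phi x != 0 ->
  'D_v (fun y => mirror_map lam phi y i 0) x =
  (Pi_lam lam phi x *:
    ((1%:M + lam *: (mirror_map lam phi x *m x^T)) *m
     (metric lam phi x *m v))) i 0.
Proof.
move=> dp D0; set w := metric lam phi x *m v.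
have dD := differentiable_mirror_denom lam dp.
rewrite mirror_map_coordE deriveM; last 2 first.
- exact: (diff_derivable (differentiableV dD D0)).
- exact: diff_derivable.
rewrite (deriveV D0); last exact: diff_derivable.
rewrite derive_mirror_denom // derive_partial_hessian //.
set g := grad phi x; set p := inner g v.
have Hv : hessian phi x *m v = w - (lam * p) *: g.
  rewrite /w /metric mulmxDl -scalemxAl -mulmxA [_^T *m v]mx11_scalar.
  by rewrite mul_mx_scalar scalerA addrK.
have xHv : inner x (hessian phi x *m v) = inner x w - lam * p * inner g x.
  by rewrite Hv innerBr innerZr (innerC x g).
rewrite xHv Hv mulmxDl mul1mx -scalemxAl -mulmxA [x^T *m w]mx11_scalar.
rewrite mul_mx_scalar -/(inner x w) /Pi_lam.
have -> : inner x (mirror_map lam phi x) =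
    (mirror_denom lam phi x)^-1 * inner g x.
  by rewrite innerZr (innerC x g).
rewrite /mirror_map -/g !mxE -/(partial i phi x) /mirror_denom -/g.
rewrite /GRing.scale/=.
move: D0; rewrite /mirror_denom -/g.
move: (inner g x) (inner x w) (partial i phi x) (w i 0).
by move=> c r gi wi cD; field.
Qed.

(** * The flow in the dual variable *)

Theorem theorem1 (R : realType) (d : nat) (lam : R) (hlam : lam != 0)
    (Theta : set 'cV[R]_d) (hopen : open Theta) (hconvex : convex_set Theta)
    (phi : 'cV[R]_d -> R) (hphi : regular_c_convex lam Theta phi)
    (f : 'cV[R]_d -> R) (hf : forall x, Theta x -> differentiable f x)
    (J : set R) (theta0 : 'cV[R]_d) (htheta0 : Theta theta0)
    (theta : R -> 'cV[R]_d)
    (hflow : conformal_mirror_flow lam Theta phi f J theta0 theta)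
    (eta : R -> 'cV[R]_d)
    (heta : forall t, J t -> eta t = mirror_map lam phi (theta t)) :
  forall t, J t ->
    is_derive_within J t eta
      (- (Pi_lam lam phi (theta t) *:
          ((1%:M + lam *: (eta t *m (theta t)^T)) *m grad f (theta t)))).
Proof.
move=> t Jt.
have Tt := cmf_in hflow Jt.
have dp i : differentiable (partial i phi) (theta t).
  by have [_ /(_ i)[dpi _]] := rcc_smooth hphi 2%N; exact: dpi.
have D0 : mirror_denom lam phi (theta t) != 0.
  by rewrite gt_eqF // (rcc_pos hphi).
pose v := - (invmx (metric lam phi (theta t)) *m grad f (theta t)).
have Gv : metric lam phi (theta t) *m v = - grad f (theta t).
  by rewrite mulmxN mulmxA mulmxV ?mul1mx //; exact: metric_unitmx hphi Tt.
rewrite /is_derive_within; set F := within _ _.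
have FF : Filter F by exact: within_filter.
have FJ : F (J `\ t) by exact: withinT.
have hne : \forall s \near F, s - t != 0.
  by apply: filterS FJ => s [_ /eqP]; rewrite subr_eq0.
have h0 : s - t @[s --> F] --> (0 : R).
  have : s - t @[s --> t] --> t - t.
    by apply: cvgB; [exact: cvg_id|exact: cvg_cst].
  by rewrite subrr; exact: cvg_within_filter.
apply: cvg_col => i.
have := cvg_quotient_diff FF hne h0 (cmf_ode hflow Jt)
          (differentiable_mirror_map_coord i dp D0).
rewrite -deriveE; last exact: differentiable_mirror_map_coord.
rewrite -/v derive_mirror_map_coord // Gv -heta // mulmxN scalerN.
(* eta is the image of theta on J only, which is enough along F. *)
apply: cvg_trans; apply: near_eq_cvg.
by apply: filterS FJ => s [Js _]; rewrite -heta // !mxE.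
Qed.
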